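(* Let $\Gamma$ be a connected bipartite graph with ordered bipartition $(B|B')$, let $G\leq\mathrm{Aut}(\Gamma)$, let $1\neq N\lhd G$, and let $r$ be an integer with $r\geq 3$. Then the following are equivalent: (a) $\Gamma$ is $r$-starlike relative to $N$, and $\Gamma$ is locally $(G,4)$-distance transitive; (b) the adjacency design $\mathcal{D}(\Gamma)$ is $G$-pairwise transitive and $N$-nicely affine with $r$ parallel classes of blocks.
   Context: All graphs are finite, simple and without loops. Locally $(G,s)$-distance transitive ($s$ a positive integer): the graph has diameter at least $s$, admits $G$ as a subgroup of automorphisms, and for each vertex $v$ and each positive integer $i\leq s$ the stabiliser $G_v$ acts transitively on the set of vertices at distance $i$ from $v$. $r$-starlike: a connected bipartite graph $\Gamma$ with ordered bipartition $(B|B')$ is $r$-starlike relative to $N$ if $N\leq\mathrm{Aut}(\Gamma)$, $r$ is an integer with $r\geq 2$, $N$ is transitive on $B$, and $N$ has $r$ orbits on $B'$. A design $\mathcal{D}=(\mathcal{P},\mathcal{B},\mathcal{I})$ consists of a point set $\mathcal{P}$, a block set $\mathcal{B}$ and an incidence relation $\mathcal{I}\subseteq\mathcal{P}\times\mathcal{B}$. An automorphism of a design is a permutation of $\mathcal{P}\cup\mathcal{B}$ preserving points, blocks and incidence. Two distinct points are collinear if they are incident with at least one common block, and non-collinear otherwise; two distinct blocks are intersecting if they are incident with at least one common point, and non-intersecting otherwise. Adjacency design: for a bipartite graph $\Gamma$ with ordered bipartition $(B|B')$, the design $\mathcal{D}(\Gamma)$ has point set $B$ and block set $B'$, a point and a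 block being incident if and only if the corresponding vertices are adjacent in $\Gamma$. $G$-pairwise transitive: $G$ is a group of automorphisms of the design and is transitive on each of the following six (possibly empty) sets: incident point-block pairs, non-incident point-block pairs, collinear point pairs, non-collinear point pairs, intersecting block pairs, non-intersecting block pairs (pairs of points and pairs of blocks are ordered pairs of distinct elements). $N$-nicely affine: $N$ is a group of automorphisms of the design that is transitive on points, and there is a constant $\mu$ such that distinct blocks are incident with exactly $\mu$ common points if they are in different $N$-orbits and are disjoint (incident with no common point) if they are in the same $N$-orbit. Each $N$-orbit on blocks is then a parallel class, that is, the point subsets incident with the blocks in the orbit partition the point set; the $r$ parallel classes in (b) are these $N$-orbits.
   Formalization: Condition (b) additionally requires that some point is not incident with some block (Γ is not complete bipartite); otherwise K_{m,r}, m≥2, with G=Sym(m)×Sym(r), N=Sym(m)×1 satisfies (b) but has diameter 2, so (a) fails. *)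

(* Defs.v *)
From mathcomp Require Import all_boot all_order all_fingroup.

Set Implicit Arguments.
Unset Strict Implicit.
Unset Printing Implicit Defensive.

Record sgraph (V : finType) := SGraph {
  adj :> rel V;
  adj_sym : symmetric adj;
  adj_irr : irreflexive adj
}.

Section Graphs.

Variables (V : finType) (Gamma : sgraph V).

Definition graph_aut : {set {perm V}} :=
  [set g : {perm V} | [forall x, forall y, Gamma (g x) (g y) == Gamma x y]].

Definition connected : Prop := forall x y : V, connect Gamma x y.

Record bipartition (B B' : {set V}) : Prop := Bipartition {
  bip_cover : B :|: B' = [set: V];
  bip_disjoint : [disjoint B & B'];
  bip_adj : forall x y, Gamma x y -> (x \in B) = (y \in B')
}.

Definition walk (n : nat) (x y : V) : bool :=
  [exists p : n.-tuple V, path Gamma x p && (last x p == y)].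

(* The least length of a walk from x to y. A shortest walk has length less
   than #|V|, so the search is exhaustive; the value is #|V| when x and y lie
   in different components. *)
Definition dist (x y : V) : nat := find (fun n => walk n x y) (iota 0 #|V|).

Definition diameter : nat := \max_(x : V) \max_(y : V) dist x y.

Definition sphere (v : V) (i : nat) : {set V} := [set u | dist v u == i].

(* Unlike [transitive H, on S | 'P], this holds when S is empty, which may
   occur for a sphere whose centre has small eccentricity. *)
Definition transitive_on (H : {set {perm V}}) (S : {set V}) : Prop :=
  {in S &, forall x y, y \in orbit 'P H x}.

Definition locally_distance_transitive (G : {group {perm V}}) (s : nat) :
    Prop :=
  [/\ 0 < s, s <= diameter, G \subset graph_aut
    & forall v i, 0 < i <= s -> transitive_on 'C_G[v | 'P]%g (sphere v i)].

(* [transitive N, on B | 'P] makes B an N-orbit, so N also preserves B' and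
   the orbits counted below are subsets of B'. *)
Record starlike (B B' : {set V}) (r : nat) (N : {group {perm V}}) : Prop :=
  Starlike {
    starlike_connected : connected;
    starlike_bipartition : bipartition B B';
    starlike_aut : N \subset graph_aut;
    starlike_ge2 : 2 <= r;
    starlike_trans : [transitive N, on B | 'P];
    starlike_orbits : #|orbit 'P N @: B'| = r
  }.

End Graphs.

(* Points and blocks are disjoint subsets of a common type T, so that one
   permutation group acts on both. *)
Record design (T : finType) := Design {
  points : {set T};
  blocks : {set T};
  incident : rel T;
  design_disjoint : [disjoint points & blocks];
  incident_sub : forall x b, incident x b -> (x \in points) && (b \in blocks)
}.

Section Designs.

Variables (T : finType) (D : design T).

(* Permutations of points D :|: blocks D, extended by the identity to T. *)
Definition design_aut : {set {perm T}} :=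
  [set g : {perm T} |
    [&& perm_on (points D :|: blocks D) g,
        g @: points D == points D,
        g @: blocks D == blocks D
      & [forall x in points D, forall b in blocks D,
           incident D (g x) (g b) == incident D x b]]].

Definition collinear (x y : T) : bool :=
  [exists b, incident D x b && incident D y b].

Definition intersecting (b c : T) : bool :=
  [exists x, incident D x b && incident D x c].

Definition incident_pairs : {set T * T} :=
  [set p in setX (points D) (blocks D) | incident D p.1 p.2].
Definition nonincident_pairs : {set T * T} :=
  [set p in setX (points D) (blocks D) | ~~ incident D p.1 p.2].
Definition collinear_pairs : {set T * T} :=
  [set p in setX (points D) (points D) | (p.1 != p.2) && collinear p.1 p.2].
Definition noncollinear_pairs : {set T * T} :=
  [set p in setX (points D) (points D) | (p.1 != p.2) && ~~ collinear p.1 p.2].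
Definition intersecting_pairs : {set T * T} :=
  [set p in setX (blocks D) (blocks D) | (p.1 != p.2) && intersecting p.1 p.2].
Definition nonintersecting_pairs : {set T * T} :=
  [set p in setX (blocks D) (blocks D)
     | (p.1 != p.2) && ~~ intersecting p.1 p.2].

Definition transitive_on_pairs (G : {set {perm T}}) (S : {set T * T}) : Prop :=
  {in S &, forall p q, exists2 g, g \in G & (g p.1, g p.2) = q}.

Record pairwise_transitive (G : {group {perm T}}) : Prop := PairwiseTransitive {
  pt_aut : G \subset design_aut;
  pt_incident : transitive_on_pairs G incident_pairs;
  pt_nonincident : transitive_on_pairs G nonincident_pairs;
  pt_collinear : transitive_on_pairs G collinear_pairs;
  pt_noncollinear : transitive_on_pairs G noncollinear_pairs;
  pt_intersecting : transitive_on_pairs G intersecting_pairs;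
  pt_nonintersecting : transitive_on_pairs G nonintersecting_pairs
}.

Definition common_points (b c : T) : {set T} :=
  [set x | incident D x b && incident D x c].

Definition nicely_affine (N : {group {perm T}}) : Prop :=
  [/\ N \subset design_aut,
      [transitive N, on points D | 'P]
    & exists mu : nat, {in blocks D &, forall b c, b != c ->
        #|common_points b c| = if c \in orbit 'P N b then 0 else mu}].

Definition parallel_classes (N : {group {perm T}}) : {set {set T}} :=
  orbit 'P N @: blocks D.

End Designs.

Fact adjacency_incident_sub (V : finType) (Gamma : sgraph V) (B B' : {set V})
    (x b : V) :
  [&& x \in B, b \in B' & Gamma x b] -> (x \in B) && (b \in B').
Proof. by case/and3P=> -> ->. Qed.

Definition adjacency_design (V : finType) (Gamma : sgraph V) (B B' : {set V})
    (bip : bipartition Gamma B B') : design V :=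
  @Design V B B' [rel x b | [&& x \in B, b \in B' & Gamma x b]]
    (bip_disjoint bip) (@adjacency_incident_sub V Gamma B B').

(* Main.v *)
(* (a) => (b): a point is adjacent to a block of every N-orbit on B'. For a block
   b, the stabiliser G_b preserves b^N; being transitive on the blocks at
   distance 2 from b, some of which lie outside b^N, it forces distinct blocks of
   one N-orbit to be disjoint. Consequently some block at distance 4 from b lies
   in b^N, hence all of them do. A third N-orbit then shortcuts any walk of
   length 6 from b to one of length at most 4: if b, d, e, c are successive blocks
   on a geodesic of length 6, then e is in b^N and c is in d^N, but a block f of a
   third orbit adjacent to the point between d and e is at distance 2 from both b
   and c. So two blocks, or two points, are at distance at most 4 and a point and
   a block at distance at most 3, and the six sets of pairs of the design are the
   sets of pairs at a given distance.
   (b) => (a): the six transitivity conditions contain the local ones, and if x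
   is not incident with b, then the block of b^N incident with x is at distance
   at least 4 from b. *)
Require Import Defs.
From mathcomp Require Import all_boot all_order all_fingroup.

Set Implicit Arguments.
Unset Strict Implicit.
Unset Printing Implicit Defensive.

(** * Walks of prescribed length, and distance *)

Section Walks.

Variables (V : finType) (Gamma : sgraph V).
Implicit Types (x y z : V) (m n : nat).

Lemma walkP n x y :
  reflect (exists p, [/\ size p = n, path Gamma x p & last x p = y])
          (walk Gamma n x y).
Proof.
apply: (iffP existsP) => [[p /andP[px /eqP lp]] | [p [sp px lp]]].
  by exists p; rewrite size_tuple.
by move/eqP: sp => sp; exists (Tuple sp); rewrite /= px lp eqxx.
Qed.

Lemma walk0 x y : walk Gamma 0 x y = (x == y).
Proof.
apply/walkP/eqP => [[p [/size0nil -> _ //]] | <-].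
by exists [::].
Qed.

Lemma walkSP n x y :
  reflect (exists2 z, Gamma x z & walk Gamma n z y) (walk Gamma n.+1 x y).
Proof.
apply: (iffP (walkP _ _ _)) => [[[|z p] [//= [sp] /andP[xz zp] lp]]|].
  by exists z => //; apply/walkP; exists p.
case=> z xz /walkP[p [sp zp lp]].
by exists (z :: p); rewrite /= sp xz.
Qed.

Lemma walk1 x y : walk Gamma 1 x y = Gamma x y.
Proof.
apply/walkSP/idP => [[z xz]|xy]; first by rewrite walk0 => /eqP <-.
by exists y; rewrite ?walk0.
Qed.

Lemma walk_cat m n x y z :
  walk Gamma m x y -> walk Gamma n y z -> walk Gamma (m + n) x z.
Proof.
elim: m x => [|m IHm] x; first by rewrite walk0 => /eqP->.
by case/walkSP=> w xw wy yz; apply/walkSP; exists w; last exact: IHm.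
Qed.

Lemma walk2 x y z : Gamma x y -> Gamma y z -> walk Gamma 2 x z.
Proof. by rewrite -!walk1; apply: (@walk_cat 1 1). Qed.

Lemma walk_split m n x z :
  walk Gamma (m + n) x z -> exists2 y, walk Gamma m x y & walk Gamma n y z.
Proof.
elim: m x => [|m IHm] x; first by exists x; rewrite ?walk0.
case/walkSP=> w xw /IHm[y wy yz]; exists y => //.
by apply/walkSP; exists w.
Qed.

Lemma walk_sym n x y : walk Gamma n x y = walk Gamma n y x.
Proof.
have sub u v : walk Gamma n u v -> walk Gamma n v u.
  elim: n u => [|n IHn] u; first by rewrite !walk0 eq_sym.
  case/walkSP=> w uw /IHn vw; rewrite -addn1; apply: walk_cat vw _.
  by rewrite walk1 adj_sym.
by apply/idP/idP; apply: sub.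
Qed.

(** The first edge is run to and fro beforehand; [0 < n] ensures that there is one. *)
Lemma walk_pad n x y : 0 < n -> walk Gamma n x y -> walk Gamma n.+2 x y.
Proof.
case: n => // n _ w; have/walkSP[z xz _] := w.
by apply/walkSP; exists z => //; apply/walkSP; exists x; rewrite // adj_sym.
Qed.

Lemma walk_aut (g : {perm V}) n x y :
  g \in graph_aut Gamma -> walk Gamma n (g x) (g y) = walk Gamma n x y.
Proof.
rewrite inE => /forallP gA.
have adjg u v : Gamma (g u) (g v) = Gamma u v.
  by move/forallP: (gA u) => /(_ v)/eqP.
elim: n x => [|n IHn] x; first by rewrite !walk0 (inj_eq perm_inj).
apply/walkSP/walkSP => -[z xz zy].
  by exists ((g^-1)%g z); [rewrite -adjg | rewrite -IHn]; rewrite permKV.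
by exists (g z); rewrite ?adjg ?IHn.
Qed.

Lemma dist_le_walk n x y : walk Gamma n x y -> dist Gamma x y <= n.
Proof.
move=> w; rewrite /dist; set a := fun k => _.
(* [find] never exceeds the length [#|V|] of the list, which settles longer walks. *)
have [ltnV|leVn] := ltnP n #|V|; last first.
  by apply: leq_trans leVn; rewrite -{2}(size_iota 0 #|V|) find_size.
rewrite leqNgt; apply/negP => /(before_find 0).
by rewrite nth_iota // add0n /a w.
Qed.

Lemma walk_dist x y :
  connect Gamma x y -> walk Gamma (dist Gamma x y) x y.
Proof.
case/connectP=> p /shortenP[q xq /card_uniqP/= uq _] lq.
have ltqV : size q < #|V| by rewrite -uq max_card.
have w : walk Gamma (size q) x y by apply/walkP; exists q.
have: has (fun k => walk Gamma k x y) (iota 0 #|V|).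
  by apply/hasP; exists (size q); rewrite // mem_iota.
move=> h; have := nth_find 0 h.
by rewrite nth_iota // -[X in _ < X](size_iota 0) -has_find.
Qed.

Lemma diameter_leP n :
  reflect (forall x y, dist Gamma x y <= n) (diameter Gamma <= n).
Proof.
apply: (iffP (bigmax_leqP _ _ _)) => [le x y | le x _].
  by have/bigmax_leqP := le x isT; apply.
by apply/bigmax_leqP.
Qed.

End Walks.

(** * Parity of walks in a connected bipartite graph *)

Section Bipartite.

Variables (V : finType) (Gamma : sgraph V) (B B' : {set V}).
Hypotheses (conn : connected Gamma) (bip : bipartition Gamma B B').
Implicit Types (x y z b c : V) (n : nat).

Lemma in_other_part x : (x \in B') = (x \notin B).
Proof.
have := in_setT x; rewrite -(bip_cover bip) inE.
by case: (boolP (x \in B)) => //= xB _; rewrite (disjointFr (bip_disjoint bip)).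
Qed.

Lemma walk_parity n x y :
  walk Gamma n x y -> (y \in B) = (x \in B) (+) odd n.
Proof.
elim: n x => [|n IHn] x; first by rewrite walk0 addbF => /eqP->.
case/walkSP=> z /(bip_adj bip); rewrite in_other_part => xz /IHn->.
by rewrite xz /= addbN addNb negbK.
Qed.

(* Parity is what makes the absence of a walk of length n sufficient: it rules
   out distance n + 1 as well. *)
Lemma dist_SSE n x y :
  (dist Gamma x y == n.+2) = walk Gamma n.+2 x y && ~~ walk Gamma n x y.
Proof.
have wd := walk_dist (conn x y).
apply/eqP/andP => [dE | [w2 nw]].
  split; first by rewrite -dE.
  by apply/negP => /dist_le_walk; rewrite dE ltnNge leqnSn.
have odd_d : odd (dist Gamma x y) = odd n.
  have := walk_parity wd; rewrite (walk_parity w2) /= negbK.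
  by move/addbI.
(* The distance may be 0 here, so the edge run to and fro is the first edge of the walk of length
   [n.+2]. *)
have extend k :
    walk Gamma (dist Gamma x y) x y -> walk Gamma (k.*2 + dist Gamma x y) x y.
  elim: k => // k IHk /IHk w; rewrite doubleS !addSn.
  have /walkSP[z xz _] := w2.
  by apply/walkSP; exists z => //; apply/walkSP; exists x; rewrite // adj_sym.
have := dist_le_walk w2; rewrite leq_eqVlt => /predU1P[// | ].
rewrite ltnS leq_eqVlt => /predU1P[dE | led].
  by move: odd_d; rewrite dE /=; case: (odd n).
case/negP: nw; have := extend (n - dist Gamma x y)./2 wd.
have -> : (n - dist Gamma x y)./2.*2 = n - dist Gamma x y.
  by rewrite even_halfK // oddB // odd_d addbb.
by rewrite subnK.
Qed.

Lemma dist_1E x y : (dist Gamma x y == 1) = Gamma x y.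
Proof.
have wd := walk_dist (conn x y).
apply/eqP/idP => [d1 | xy]; first by rewrite -walk1 -d1.
apply/anti_leq; rewrite dist_le_walk ?walk1 // lt0n.
apply: contraTneq xy => d0; move: wd; rewrite d0 walk0 => /eqP->.
by rewrite adj_irr.
Qed.

Lemma has_neighbour x y : x != y -> exists z, Gamma x z.
Proof.
move=> neq; have := walk_dist (conn x y).
case: (dist _ _ _) => [|n]; first by rewrite walk0 (negPf neq).
by case/walkSP=> z; exists z.
Qed.

End Bipartite.

(** * Orbits of a normal subgroup *)

Section NormalOrbits.

Variables (V : finType) (G N : {group {perm V}}).
Hypothesis nNG : (N <| G)%g.
Implicit Types (x y : V) (g : {perm V}).

(** Conjugation by [g] preserves [N], so [G] permutes the [N]-orbits. *)
Lemma normal_orbit g x y :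
  g \in G -> (g y \in orbit 'P N (g x)) = (y \in orbit 'P N x).
Proof.
have sub h u v : h \in G -> v \in orbit 'P N u -> h v \in orbit 'P N (h u).
  move=> hG /orbitP[n nN <-]; apply/orbitP; exists (n ^ h)%g.
    by rewrite memJ_norm // (subsetP (normal_norm nNG)).
  by rewrite /= !apermE -permM -conjgC permM.
move=> gG; apply/idP/idP; last exact: sub.
by move=> /(sub g^-1%g); rewrite !permK groupV; apply.
Qed.

(** [x] and [y] account for at most two orbits. They may lie outside [S], and [x = y] simply yields
    another orbit. *)
Lemma third_orbit (S : {set V}) x y :
  2 < #|orbit 'P N @: S| ->
  exists2 z, z \in S & (z \notin orbit 'P N x) && (z \notin orbit 'P N y).
Proof.
move=> gt2; pose O := [set orbit 'P N x; orbit 'P N y].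
have /subsetPn[_ /imsetP[z zS ->] zO] : ~~ (orbit 'P N @: S \subset O).
  apply: contraL gt2 => /subset_leq_card leO; rewrite -leqNgt.
  by apply: leq_trans leO _; rewrite cards2; case: eqP.
exists z => //; move: zO; rewrite !inE negb_or => /andP[zx zy].
by apply/andP; split; [move: zx | move: zy]; apply: contra => /orbit_eqP->.
Qed.

End NormalOrbits.

(** * Distances between points and blocks under (a) *)

Section StarlikeDistanceTransitive.

Variables (V : finType) (Gamma : sgraph V) (B B' : {set V}).
Hypotheses (conn : connected Gamma) (bip : bipartition Gamma B B').
Variables (G N : {group {perm V}}).
Hypotheses (nNG : (N <| G)%g) (ge3orb : 3 <= #|orbit 'P N @: B'|).
Hypotheses (transN : [transitive N, on B | 'P]).
Hypothesis ldtG : locally_distance_transitive Gamma G 4.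
Implicit Types (x y z b c d e f : V) (g : {perm V}).

Let autG g : g \in G -> g \in graph_aut Gamma.
Proof. by case: ldtG => _ _ /subsetP + _; apply. Qed.

Let sNG g : g \in N -> g \in G.
Proof. exact/subsetP/normal_sub. Qed.

Let inB' := in_other_part bip.

Let transB x y : x \in B -> y \in B -> exists2 g, g \in N & g x = y.
Proof. by move=> xB yB; have [g gN ->] := atransP2 transN xB yB; exists g. Qed.

(** Local transitivity at the distances 2, 3 and 4, with the spheres cut out by walks as in
    [dist_SSE]. *)
Lemma sphere_trans v x y n :
  n <= 2 -> walk Gamma n.+2 v x -> ~~ walk Gamma n v x ->
  walk Gamma n.+2 v y -> ~~ walk Gamma n v y ->
  exists g, [/\ g \in G, g v = v & g x = y].
Proof.
move=> le2 x1 x2 y1 y2; case: ldtG => _ _ _ /(_ v n.+2).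
rewrite !ltnS le2 => /(_ isT x y).
rewrite !inE !(dist_SSE conn bip) x1 x2 y1 y2 => /(_ isT isT)/orbitP[g].
by case/setIP=> gG /astab1P gv gx; exists g.
Qed.

Lemma neighbours_trans v x y :
  Gamma v x -> Gamma v y -> exists g, [/\ g \in G, g v = v & g x = y].
Proof.
move=> vx vy; case: ldtG => _ _ _ /(_ v 1 isT x y).
rewrite !inE !(dist_1E conn) vx vy => /(_ isT isT)/orbitP[g].
by case/setIP=> gG /astab1P gv gx; exists g.
Qed.

(* Otherwise a block is the image of a point, so B', like B, would be a single
   N-orbit. *)
Lemma stable_points g x : g \in G -> (g x \in B) = (x \in B).
Proof.
have sub h y : h \in G -> y \in B -> h y \in B.
  move=> hG yB; apply: contraT => hyB.
  have [c cB' /andP[]] := third_orbit (h y) (h y) ge3orb.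
  have [c' def_c] : exists c', c = h c' by exists (h^-1 c)%g; rewrite permKV.
  rewrite {}def_c in cB' *; case/negP; rewrite (normal_orbit nNG) //.
  (* A walk from [y] to [c'] and its image under [h] have equal length. Since [h y] and [h c'] both
     lie in [B'], parity puts [y] and [c'] in the same part. *)
  have c'B : c' \in B.
    have w := walk_dist (conn y c').
    have hw := w; rewrite -(walk_aut _ _ _ (autG hG)) in hw.
    move: cB'; rewrite inB' (walk_parity bip w) (walk_parity bip hw) yB.
    by rewrite (negPf hyB); case: odd.
  by have [n nN <-] := transB yB c'B; apply: mem_orbit.
move=> gG; apply/idP/idP; last exact: sub.
by move=> /(sub g^-1%g); rewrite permK groupV; apply.
Qed.

Lemma block_adj b : b \in B' -> exists2 x, x \in B & Gamma b x.
Proof.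
rewrite inB' => bB'; have [x xB] : exists x, x \in B.
  by case/imsetP: transN => x xB _; exists x.
have [|y by_] := @has_neighbour _ _ conn b x.
  by apply: contraNneq bB' => ->.
by exists y => //; rewrite (bip_adj bip (y := b)) ?inB' // adj_sym.
Qed.

Lemma adj_point b x : b \in B' -> Gamma b x -> x \in B.
Proof. by move=> bB' bx; rewrite (bip_adj bip (y := b)) // adj_sym. Qed.

(** [N] carries [x] to [y], and the stabiliser of [y] in [G] then adjusts the block. *)
Lemma flag_trans x b y c : x \in B -> y \in B -> Gamma x b -> Gamma y c ->
  exists g, [/\ g \in G, g x = y & g b = c].
Proof.
move=> xB yB xb yc; have [n nN nx] := transB xB yB.
have [|g [gG gy gc]] := @neighbours_trans y (n b) c _ yc.
  by rewrite -nx -walk1 walk_aut ?walk1 // autG ?sNG.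
by exists (n * g)%g; rewrite !permM nx gy gc (groupM (sNG nN) gG).
Qed.

Lemma block_trans b c : b \in B' -> c \in B' -> exists2 g, g \in G & g b = c.
Proof.
move=> /block_adj[x xB bx] /block_adj[y yB cy].
have [||g [gG _ gb]] := @flag_trans x b y c xB yB; rewrite 1?adj_sym //.
by exists g.
Qed.

(** An element of [N] moving a point of [b] to [x] moves [b] to such a block. *)
Lemma orbit_adj x b :
  x \in B -> b \in B' -> exists2 e, e \in orbit 'P N b & Gamma x e.
Proof.
move=> xB /block_adj[y yB by_]; have [n nN nx] := transB yB xB.
exists (n b); first exact: mem_orbit.
by rewrite -nx -walk1 walk_aut ?walk1 1?adj_sym // autG ?sNG.
Qed.

Lemma orbit_block b e : b \in B' -> e \in orbit 'P N b -> e \in B'.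
Proof.
by move=> bB' /orbitP[n nN <-]; rewrite inB' /= stable_points ?sNG // -inB'.
Qed.

(* The stabiliser of b preserves its N-orbit, whereas the blocks at distance 2
   from b, on which it is transitive, meet other N-orbits. *)
Lemma same_orbit_disjoint b c :
  b \in B' -> c \in orbit 'P N b -> walk Gamma 2 b c -> b = c.
Proof.
move=> bB' cb w2; apply/eqP/contraT; rewrite -(walk0 Gamma) => nbc.
have/walkSP[x bx _] := w2; have xB := adj_point bB' bx.
have [f fB' /andP[fb _]] := third_orbit b b ge3orb.
have [d df xd] := orbit_adj xB fB'.
have db : d \notin orbit 'P N b.
  by apply: contra fb => db; rewrite orbit_sym in df; apply: orbit_trans df db.
have [||g [gG gb gc]] := @sphere_trans b c d 0 _ w2 nbc (walk2 bx xd) => //.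
  by apply: contra db; rewrite walk0 => /eqP<-; apply: orbit_refl.
by case/negP: db; rewrite -gc -gb (normal_orbit nNG).
Qed.

(** A geodesic of length at least 3 is cut after three edges. The odd length puts one end in each
    part, whereas a pair at distance 4 might consist of points. *)
Lemma exists_at_distance3 :
  exists b x, [/\ b \in B', walk Gamma 3 b x & ~~ walk Gamma 1 b x].
Proof.
have [u [v dist_uv]] : exists u v, 2 < dist Gamma u v.
  case: (boolP [forall u, forall v, dist Gamma u v <= 2]) => [/forallP le2 |].
    case: ldtG => _ /(leq_trans (isT : 2 < 4)) + _ _; rewrite ltnNge => /negP[].
    by apply/diameter_leP => u v; move/forallP: (le2 u).
  by case/forallPn=> u /forallPn[v]; rewrite -ltnNge; exists u, v.
have := walk_dist (conn u v); rewrite -{1}(subnKC dist_uv).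
case/walk_split=> w uw wv.
have nuw : ~~ walk Gamma 1 u w.
  apply/negP => uw1; have := dist_le_walk (walk_cat uw1 wv).
  by rewrite leqNgt -{2}(subnKC dist_uv) ltn_add2r.
have [uB | uB] := boolP (u \in B); last by exists u, w; rewrite inB'.
exists w, u; rewrite inB' (walk_parity bip uw) uB ![walk _ _ w u]walk_sym.
by split.
Qed.

(** One pair of blocks at distance 4 inside an orbit suffices: [G] is transitive on blocks, each
    block stabiliser is transitive on the sphere of radius 4, and [G] permutes the [N]-orbits. *)
Lemma walk4_same_orbit b c : b \in B' ->
  walk Gamma 4 b c -> (c \in orbit 'P N b) || walk Gamma 2 b c.
Proof.
move=> bB' w4; rewrite orbC -implyNb; apply/implyP => n2.
have [b0 [x [b0B' w3 nw1]]] := exists_at_distance3.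
have xB : x \in B.
  by rewrite (walk_parity bip w3) -[_ \in B]negbK -inB' b0B'.
have [e0 e0b0 xe0] := orbit_adj xB b0B'.
have e4 : walk Gamma 4 b0 e0 by apply: (walk_cat w3); rewrite walk1.
(* A common point would force [e0 = b0], but [b0] is not incident with [x]. *)
have e2 : ~~ walk Gamma 2 b0 e0.
  apply/negP => /(same_orbit_disjoint b0B' e0b0) def_e0.
  by rewrite -def_e0 in xe0; rewrite walk1 adj_sym xe0 in nw1.
have [g gG gb0] := block_trans b0B' bB'.
have [|||h [hG hb hc]] := @sphere_trans b (g e0) c 2 _ _ _ w4 n2 => //.
- by rewrite -gb0 walk_aut ?autG.
- by rewrite -gb0 walk_aut ?autG.
by rewrite -hc -hb (normal_orbit nNG) // -gb0 (normal_orbit nNG).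
Qed.

Lemma walk6_walk4 b c : b \in B' -> walk Gamma 6 b c -> walk Gamma 4 b c.
Proof.
move=> bB' /(@walk_split _ _ 4 2)[e /(@walk_split _ _ 2 2)[d bd de] ec].
have [be | nbe] := boolP (walk Gamma 2 b e); first exact: (walk_cat be ec).
have [dc | ndc] := boolP (walk Gamma 2 d c); first exact: (walk_cat bd dc).
have blockw u v : u \in B' -> walk Gamma 2 u v -> v \in B'.
  by rewrite !inB' => uB' /(walk_parity bip) ->; rewrite addbF.
have dB' := blockw _ _ bB' bd; have eB' := blockw _ _ dB' de.
have/walkSP[y dy] := de; rewrite walk1 => ye; have yB := adj_point dB' dy.
have [f0 f0B' /andP[f0b f0d]] := third_orbit b d ge3orb.
have [f ff0 yf] := orbit_adj yB f0B'.
have trN u v w : u \in orbit 'P N v -> u \in orbit 'P N w -> v \in orbit 'P N w.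
  rewrite orbit_sym => uv uw; exact: orbit_trans uv uw.
(* [f] is reached from [b] in four steps through [d] and [y], and lies outside the orbit of [b]. *)
have bf : walk Gamma 2 b f.
  have/(walk4_same_orbit bB')/orP[fb|//] : walk Gamma 4 b f.
    exact: walk_cat bd (walk2 dy yf).
  by rewrite (trN f) in f0b.
have fe : walk Gamma 2 f e by apply: walk2 ye; rewrite adj_sym.
(* If [c] were in the orbit of [f], then, being also in the orbit of [d] at distance 4, it would
   identify these two orbits, against the choice of [f0]. *)
have /(walk4_same_orbit (blockw _ _ bB' bf))/orP[cf|fc] := walk_cat fe ec.
  have /(walk4_same_orbit dB')/orP[cd|] := walk_cat de ec; last first.
    by rewrite (negPf ndc).
  by rewrite (trN f _ _ ff0 (trN c _ _ cf cd)) in f0d.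
exact: walk_cat bf fc.
Qed.

(** Induction on half the length of a walk: two edges put before a walk of length 4 give length 6,
    which contracts to 4 again. *)
Lemma blocks_walk4 b c : b \in B' -> c \in B' -> walk Gamma 4 b c.
Proof.
move=> bB' cB'; have w := walk_dist (conn b c).
have even_d : ~~ odd (dist Gamma b c).
  move: bB' cB'; rewrite !inB' (walk_parity bip w) => /negPf->.
  by case: odd.
move: w; rewrite -(even_halfK even_d); move: _./2 => k {even_d}.
elim: k b bB' => [|k IHk] b bB'.
  rewrite walk0 => /eqP<-; have [x _ bx] := block_adj bB'.
  by apply: walk_pad (walk2 bx _); rewrite 1?adj_sym.
rewrite doubleS => /(@walk_split _ _ 2)[d bd dc].
apply: (walk6_walk4 bB' (walk_cat bd (IHk _ _ dc))).
by move: bB'; rewrite !inB' (walk_parity bip bd) addbF.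
Qed.

Lemma other_orbit_walk2 b c :
  b \in B' -> c \in B' -> c \notin orbit 'P N b -> walk Gamma 2 b c.
Proof.
move=> bB' cB'; have := walk4_same_orbit bB' (blocks_walk4 bB' cB').
by case: (_ \in _).
Qed.

(** Some block through [x] belongs to an orbit other than that of [b], and so meets [b]. *)
Lemma point_block_walk3 x b : x \in B -> b \in B' -> walk Gamma 3 x b.
Proof.
move=> xB bB'; have [f fB' /andP[fb _]] := third_orbit b b ge3orb.
have [c cf xc] := orbit_adj xB fB'.
apply/walkSP; exists c => //; rewrite walk_sym.
apply: other_orbit_walk2 => //; first exact: orbit_block cf.
by apply: contra fb => /(orbit_trans _); apply; rewrite orbit_sym.
Qed.

Lemma points_walk4 x y : x \in B -> y \in B -> walk Gamma 4 x y.
Proof.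
move=> xB yB; have [f fB' _] := third_orbit x x ge3orb.
have [c cf yc] := orbit_adj yB fB'.
rewrite walk_sym; apply/walkSP; exists c => //; rewrite walk_sym.
by apply: point_block_walk3 => //; apply: orbit_block cf.
Qed.

End StarlikeDistanceTransitive.

(** * The adjacency design in terms of walks *)

Section AdjacencyDesign.

Variables (V : finType) (Gamma : sgraph V) (B B' : {set V}).
Hypotheses (conn : connected Gamma) (bip : bipartition Gamma B B').
Let D := adjacency_design bip.
Implicit Types (x y b c : V) (p : V * V).

Lemma incidentE x b : incident D x b = (x \in B) && Gamma x b.
Proof.
rewrite /=; case xB: (x \in B) => //=.
by case xb: (Gamma x b); rewrite ?andbF // -(bip_adj bip xb) xB.
Qed.

Lemma collinearE x y : x \in B -> y \in B -> collinear D x y = walk Gamma 2 x y.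
Proof.
move=> xB yB; apply/existsP/walkSP => -[b].
  rewrite !incidentE => /andP[/andP[_ xb] /andP[_ yb]].
  by exists b; rewrite // walk1 adj_sym.
by move=> xb by_; exists b; rewrite !incidentE xB yB xb -walk1 walk_sym.
Qed.

Lemma incident_block x b : b \in B' -> incident D x b = Gamma b x.
Proof.
move=> bB'; rewrite incidentE adj_sym andbC.
by case bx: (Gamma b x) => //=; rewrite (bip_adj bip (y := b)) // adj_sym.
Qed.

Lemma intersectingE b c :
  b \in B' -> c \in B' -> intersecting D b c = walk Gamma 2 b c.
Proof.
move=> bB' cB'; apply/existsP/walkSP => -[x].
  rewrite !incident_block // => /andP[bx cx].
  by exists x; rewrite // walk1 adj_sym.
by move=> bx xc; exists x; rewrite !incident_block // bx -walk1 walk_sym.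
Qed.

Lemma mem_incident_pairs p :
  (p \in incident_pairs D) = (p.1 \in B) && Gamma p.1 p.2.
Proof.
rewrite !inE incidentE; case: (boolP (p.1 \in B)) => //= p1B.
by case e: (Gamma _ _); rewrite ?andbF // -(bip_adj bip e) p1B.
Qed.

Lemma mem_nonincident_pairs p : (p \in nonincident_pairs D) =
  [&& p.1 \in B, p.2 \in B' & ~~ walk Gamma 1 p.1 p.2].
Proof. by rewrite !inE incidentE walk1 -andbA; case: (p.1 \in B). Qed.

(** Distinctness is written as the absence of a walk of length 0, to fit the hypotheses of
    [sphere_trans]. *)
Lemma mem_collinear_pairs p : (p \in collinear_pairs D) =
  [&& p.1 \in B, p.2 \in B, ~~ walk Gamma 0 p.1 p.2 & walk Gamma 2 p.1 p.2].
Proof.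
rewrite !inE walk0 -andbA /=; case p1: (p.1 \in B) => //=.
by case p2: (p.2 \in B) => //=; rewrite collinearE.
Qed.

Lemma mem_noncollinear_pairs p : (p \in noncollinear_pairs D) =
  [&& p.1 \in B, p.2 \in B, ~~ walk Gamma 0 p.1 p.2 & ~~ walk Gamma 2 p.1 p.2].
Proof.
rewrite !inE walk0 -andbA /=; case p1: (p.1 \in B) => //=.
by case p2: (p.2 \in B) => //=; rewrite collinearE.
Qed.

Lemma mem_intersecting_pairs p : (p \in intersecting_pairs D) =
  [&& p.1 \in B', p.2 \in B', ~~ walk Gamma 0 p.1 p.2 & walk Gamma 2 p.1 p.2].
Proof.
rewrite !inE walk0 -andbA /=; case p1: (p.1 \in B') => //=.
by case p2: (p.2 \in B') => //=; rewrite intersectingE.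
Qed.

Lemma mem_nonintersecting_pairs p : (p \in nonintersecting_pairs D) =
  [&& p.1 \in B', p.2 \in B', ~~ walk Gamma 0 p.1 p.2
    & ~~ walk Gamma 2 p.1 p.2].
Proof.
rewrite !inE walk0 -andbA /=; case p1: (p.1 \in B') => //=.
by case p2: (p.2 \in B') => //=; rewrite intersectingE.
Qed.

Lemma graph_aut_design_aut (g : {perm V}) :
  g \in graph_aut Gamma -> {mono g : x / x \in B} -> g \in design_aut D.
Proof.
rewrite inE => /forallP gA gB.
have adjg x y : Gamma (g x) (g y) = Gamma x y.
  by move/forallP: (gA x) => /(_ y)/eqP.
have gB' : {mono g : x / x \in B'} by move=> x; rewrite !(in_other_part bip) gB.
have imset_mono (S : {set V}) : {mono g : x / x \in S} -> g @: S == S.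
  move=> gS; rewrite eqEcard card_imset ?leqnn ?andbT; last exact: perm_inj.
  by apply/subsetP => _ /imsetP[x xS ->]; rewrite gS.
rewrite inE; apply/and4P; split; try exact: imset_mono.
  by apply/subsetP => x _; rewrite (bip_cover bip).
apply/forall_inP => x xB; apply/forall_inP => b bB'.
by rewrite !incidentE adjg gB.
Qed.

(** * From (a) to (b) *)

Section StarlikeToDesign.

Variables (G N : {group {perm V}}).
Hypotheses (nNG : (N <| G)%g) (ge3orb : 3 <= #|orbit 'P N @: B'|).
Hypotheses (transN : [transitive N, on B | 'P]).
Hypothesis ldtG : locally_distance_transitive Gamma G 4.

Let autG g : g \in G -> g \in graph_aut Gamma.
Proof. by case: ldtG => _ _ /subsetP + _; apply. Qed.

Let sNG g : g \in N -> g \in G.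
Proof. exact/subsetP/normal_sub. Qed.

Let design_autG g : g \in G -> g \in design_aut D.
Proof.
move=> gG; apply: graph_aut_design_aut => [|x]; first exact: autG.
exact: (stable_points conn bip nNG ge3orb transN ldtG).
Qed.

Let transGB x y : x \in B -> y \in B -> exists2 g, g \in G & g x = y.
Proof.
by move=> xB yB; have [g /sNG gG ->] := atransP2 transN xB yB; exists g.
Qed.

Lemma distance_pairs_trans n x y u v : n <= 2 ->
  (exists2 g, g \in G & g x = u) ->
  walk Gamma n.+2 x y -> ~~ walk Gamma n x y ->
  walk Gamma n.+2 u v -> ~~ walk Gamma n u v ->
  exists2 g, g \in G & (g x, g y) = (u, v).
Proof.
move=> le2 [g gG <-] w1 w2 w3 w4.
have [||h [hG hu hv]] :=
  @sphere_trans _ _ _ _ conn bip _ ldtG (g x) (g y) v n le2 _ _ w3 w4.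
- by rewrite walk_aut ?autG.
- by rewrite walk_aut ?autG.
by exists (g * h)%g; rewrite ?groupM // !permM hu hv.
Qed.

Lemma starlike_pairwise_transitive : pairwise_transitive D G.
Proof.
have blocksG := block_trans conn bip nNG transN ldtG.
have w4P := points_walk4 conn bip nNG ge3orb transN ldtG.
have w3 := point_block_walk3 conn bip nNG ge3orb transN ldtG.
have w4B := blocks_walk4 conn bip nNG ge3orb transN ldtG.
split; first exact/subsetP; move=> [x b] [y c].
- rewrite !mem_incident_pairs => /andP[/= xB xb] /andP[/= yB yc].
  have [g [gG gx gb]] := flag_trans conn nNG transN ldtG xB yB xb yc.
  by exists g; rewrite //= gx gb.
- rewrite !mem_nonincident_pairs => /and3P[/= xB bB' xb] /and3P[/= yB cB' yc].
  (* The relevant distance is [n.+2]: 3 for non-incident pairs, 2 for collinear or intersecting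
     pairs, 4 for the remaining two kinds. *)
  by apply: (distance_pairs_trans (n := 1)); auto.
- rewrite !mem_collinear_pairs => /and4P[/= ? ? ? ?] /and4P[/= ? ? ? ?].
  by apply: (distance_pairs_trans (n := 0)); auto.
- rewrite !mem_noncollinear_pairs => /and4P[/= ? ? ? ?] /and4P[/= ? ? ? ?].
  by apply: (distance_pairs_trans (n := 2)); auto.
- rewrite !mem_intersecting_pairs => /and4P[/= ? ? ? ?] /and4P[/= ? ? ? ?].
  by apply: (distance_pairs_trans (n := 0)); auto.
rewrite !mem_nonintersecting_pairs => /and4P[/= ? ? ? ?] /and4P[/= ? ? ? ?].
by apply: (distance_pairs_trans (n := 2)); auto.
Qed.

Lemma common_points_aut (g : {perm V}) b c : g \in G ->
  #|common_points D (g b) (g c)| = #|common_points D b c|.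
Proof.
move=> gG; have incg x y : incident D (g x) (g y) = incident D x y.
  rewrite !incidentE -!(walk1 Gamma) (walk_aut _ _ _ (autG gG)).
  by rewrite (stable_points conn bip nNG ge3orb transN ldtG).
suff -> : common_points D (g b) (g c) = g @: common_points D b c.
  by rewrite card_imset //; apply: perm_inj.
apply/setP=> y; rewrite -[y](permKV g) mem_imset; last exact: perm_inj.
by rewrite !in_set !incg.
Qed.

Lemma starlike_nicely_affine : nicely_affine D N.
Proof.
split=> //; first by apply/subsetP => n /sNG; apply: design_autG.
have w2 := other_orbit_walk2 conn bip nNG ge3orb transN ldtG.
have common0 b c : b \in B' -> c \in B' -> b != c -> c \in orbit 'P N b ->
    #|common_points D b c| = 0.
  move=> bB' cB' neq cb; apply: eq_card0 => x; apply: contraNF neq.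
  rewrite inE !incident_block // => /andP[bx cx]; apply/eqP.
  apply: (same_orbit_disjoint conn bip nNG ge3orb transN ldtG bB' cb).
  by apply: walk2 bx _; rewrite adj_sym.
(* Blocks of different orbits are at distance 2, so [G] is transitive on such pairs and any one of
   them gives the constant. *)
have [/existsP[[b0 c0] /and3P[/= b0B' c0B' cb0]] | none] :=
  boolP [exists p, [&& p.1 \in B', p.2 \in B' & p.2 \notin orbit 'P N p.1]].
- exists #|common_points D b0 c0| => b c bB' cB' neq.
  have [cb | cb] := ifPn; first exact: common0.
  have [g gG [<- <-]] : exists2 g, g \in G & (g b0, g c0) = (b, c).
    apply: (@distance_pairs_trans 0) => //; rewrite ?w2 //.
    + exact: (block_trans conn bip nNG transN ldtG).
    + by rewrite walk0; apply: contraNneq cb0 => ->; apply: orbit_refl.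
    by rewrite walk0.
  exact: common_points_aut.
(* In this case all blocks share one orbit, and any constant would serve. *)
exists 0 => b c bB' cB' neq; rewrite if_same; apply: common0 => //.
by move/existsPn/(_ (b, c)): none; rewrite /= bB' cB' negbK.
Qed.

Lemma starlike_nonincident : nonincident_pairs D != set0.
Proof.
have [b [x [bB' w3 nw1]]] := exists_at_distance3 conn bip ldtG.
apply/set0Pn; exists (x, b).
rewrite mem_nonincident_pairs /= bB' walk_sym nw1 andbT.
by rewrite (walk_parity bip w3) -[_ \in _]negbK -(in_other_part bip) bB'.
Qed.

End StarlikeToDesign.

(** * From (b) to local distance transitivity *)

Lemma pairwise_transitive_ldt (G N : {group {perm V}}) :
    G \subset graph_aut Gamma -> (N <| G)%g ->
    pairwise_transitive D G -> nicely_affine D N ->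
    nonincident_pairs D != set0 ->
  locally_distance_transitive Gamma G 4.
Proof.
move=> autG nNG [_ ptI ptN ptC ptNC ptX ptNX] [_ transN [mu muE]].
case/set0Pn=> [[x b]]; rewrite mem_nonincident_pairs => /and3P[/= xB bB' nxb].
split=> //.
  (* A point [y] of [b] is moved to [x] by some [n] in [N]. Then [n b] contains [x], so differs from
     [b], and is disjoint from it; parity leaves distance at least 4. *)
  have [y by_] : exists y, Gamma b y.
    apply: (has_neighbour conn (y := x)); apply: contraTneq xB => <-.
    by rewrite -(in_other_part bip).
  have yB : y \in B by rewrite (bip_adj bip (y := b)) // adj_sym.
  have [n nN nx] := atransP2 transN yB xB; rewrite /= apermE in nx.
  have nG : n \in G := subsetP (normal_sub nNG) n nN.
  have xnb : Gamma x (n b).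
    rewrite nx -walk1 walk_aut ?walk1 1?adj_sym //; exact: (subsetP autG).
  have nbB' : n b \in B' by rewrite -(bip_adj bip xnb).
  have neq : b != n b by apply: contraNneq nxb => ->; rewrite walk1.
  have nw2 : ~~ walk Gamma 2 b (n b).
    rewrite -intersectingE //; apply/existsP => -[z zb].
    have := muE b (n b) bB' nbB' neq; rewrite (mem_orbit 'P b nN : n b \in _).
    by move/card0_eq/(_ z); rewrite inE zb.
  have w := walk_dist (conn b (n b)).
  apply: leq_trans (_ : dist Gamma b (n b) <= _).
    have := walk_parity bip w; move: (bB') (nbB').
    rewrite !(in_other_part bip) => /negPf-> /negPf->.
    case: (dist _ _ _) w => [|[|[|[|]]]] //; rewrite ?(negPf nw2) //.
    by rewrite walk0 (negPf neq).
  by apply/diameter_leP.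
(* An element carrying one pair to another with the same first entry fixes that entry. [bwd] is the
   analogue for the second entry, used when the centre is a block and the pairs list the point
   first. *)
have fwd S v y z : transitive_on_pairs G S -> (v, y) \in S -> (v, z) \in S ->
    z \in orbit 'P 'C_G[v | 'P] y.
  move=> tr vy vz; have [g gG [gv <-]] := tr _ _ vy vz.
  by apply: (mem_orbit 'P y); rewrite inE gG; apply/astab1P.
have bwd S v y z : transitive_on_pairs G S -> (y, v) \in S -> (z, v) \in S ->
    z \in orbit 'P 'C_G[v | 'P] y.
  move=> tr yv zv; have [g gG [<- gv]] := tr _ _ yv zv.
  by apply: (mem_orbit 'P y); rewrite inE gG; apply/astab1P.
have inB' := in_other_part bip.
have sphereP v y i : y \in sphere Gamma v i ->
    [/\ walk Gamma i v y, forall n, n < i -> ~~ walk Gamma n v y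
      & (y \in B) = (v \in B) (+) odd i].
  rewrite inE => /eqP<-; split=> [|n|]; first exact: walk_dist.
    by rewrite ltnNge; apply/contra/dist_le_walk.
  exact/(walk_parity bip)/walk_dist.
move=> v [|[|[|[|[|i]]]]] // _ y z /sphereP[vy nvy yE] /sphereP[vz nvz zE];
  case: (boolP (v \in B)) yE zE => vB /= yB zB.
- by apply: (fwd _ v y z ptI); rewrite mem_incident_pairs /=
    vB -walk1.
- by apply: (bwd _ v y z ptI); rewrite mem_incident_pairs /=
    ?yB ?zB -walk1 walk_sym.
- by apply: (fwd _ v y z ptC); rewrite mem_collinear_pairs /=
    vB ?yB ?zB ?nvy ?nvz.
- by apply: (fwd _ v y z ptX); rewrite mem_intersecting_pairs /=
    !inB' vB ?yB ?zB ?nvy ?nvz.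
- by apply: (fwd _ v y z ptN); rewrite mem_nonincident_pairs /=
    inB' vB ?yB ?zB ?nvy ?nvz.
- by apply: (bwd _ v y z ptN); rewrite mem_nonincident_pairs /=
    inB' vB ?yB ?zB walk_sym ?nvy ?nvz.
- by apply: (fwd _ v y z ptNC); rewrite mem_noncollinear_pairs /=
    vB ?yB ?zB ?nvy ?nvz.
- by apply: (fwd _ v y z ptNX); rewrite mem_nonintersecting_pairs /=
    !inB' vB ?yB ?zB ?nvy ?nvz.
Qed.

End AdjacencyDesign.

Theorem theorem1p4 (V : finType) (Gamma : sgraph V) (B B' : {set V})
    (conn : connected Gamma) (bip : bipartition Gamma B B')
    (G N : {group {perm V}}) (autG : G \subset graph_aut Gamma)
    (ntN : N :!=: 1%g) (nNG : (N <| G)%g) (r : nat) (ge3r : 3 <= r) :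
  (* (a) *)
  (starlike Gamma B B' r N /\ locally_distance_transitive Gamma G 4)
  <->
  (* (b); the last conjunct excludes the complete bipartite graph K_{m,r}
     with G = Sym(m) x Sym(r) and N = Sym(m) x 1, which has diameter 2 but
     satisfies the other three. *)
  [/\ pairwise_transitive (adjacency_design bip) G,
      nicely_affine (adjacency_design bip) N,
      #|parallel_classes (adjacency_design bip) N| = r
    & nonincident_pairs (adjacency_design bip) != set0].
Proof.
split=> [[[_ _ autN _ transN orbN] ldtG] | [ptG affN classesN ni]].
  have ge3orb : 3 <= #|orbit 'P N @: B'| by rewrite orbN.
  split=> //.
  - exact: starlike_pairwise_transitive transN ldtG.
  - exact: starlike_nicely_affine transN ldtG.
  - exact: starlike_nonincident ldtG.
split; last exact: pairwise_transitive_ldt ptG affN ni.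
split=> //; first exact: subset_trans (normal_sub nNG) autG.
  exact: ltnW.
by case: affN.
Qed.
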